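(* Let $k$ be an algebraically closed field and let $f,f_1,\ldots,f_s\in k[x_1,\ldots,x_n]$. Then $f$ belongs to the polynomial ideal $\langle f_1,\ldots,f_s\rangle$ if and only if for any $p\in k[x_1,\ldots,x_n]$ and any $x\in k^n$ the following implication holds: if $$[D^\alpha p](D)f_i(x)=0,\quad i=1,\ldots,s,\ \text{for all }\alpha\in\mathbb Z_+^n,$$ then $$[D^\alpha p](D)f(x)=0\quad\text{for all }\alpha\in\mathbb Z_+^n.$$
   Context: $\mathbb Z_+$ denotes the set of nonnegative integers. For $\alpha=(\alpha_1,\ldots,\alpha_n)\in\mathbb Z_+^n$, $D^\alpha=\left(\frac{\partial}{\partial x_1}\right)^{\alpha_1}\cdots\left(\frac{\partial}{\partial x_n}\right)^{\alpha_n}$ is the (formal) partial derivative acting on $k[x_1,\ldots,x_n]$. For a polynomial $q=\sum_\alpha q_\alpha x^\alpha\in k[x_1,\ldots,x_n]$, $q(D)=\sum_\alpha q_\alpha D^\alpha$ is the corresponding constant-coefficient partial differential operator. Thus $[D^\alpha p](D)$ is the operator given by the polynomial $D^\alpha p$, and $[D^\alpha p](D)g(x)$ is the value at the point $x$ of the polynomial obtained by applying this operator to $g$. $\langle f_1,\ldots,f_s\rangle$ is the ideal of $k[x_1,\ldots,x_n]$ generated by $f_1,\ldots,f_s$.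
   Formalization: The field k is additionally assumed to have characteristic zero; in characteristic p > 0 the claim fails, e.g. for n = 1, f_1 = x^{2p}, f = x^p, where the implication always holds but f is not in the ideal generated by f_1. *)

(* Defs.v *)
From mathcomp Require Import all_boot all_algebra.
From mathcomp.multinomials Require Import mpoly.

Set Implicit Arguments.
Unset Strict Implicit.
Unset Printing Implicit Defensive.

Import GRing.Theory.

Local Open Scope ring_scope.

(* The constant-coefficient differential operator q(D) applied to g; the
   coefficients of q outside msupp q vanish. *)
Definition mpoly_diffop (R : nzRingType) (n : nat) (q g : {mpoly R[n]}) :
    {mpoly R[n]} :=
  \sum_(m <- msupp q) q@_m *: g^`M[m].

Definition in_gen_ideal (R : comNzRingType) (s : nat) (F : 'I_s -> R) (f : R) :
    Prop :=
  exists g : 'I_s -> R, f = \sum_(i < s) g i * F i.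

(* Main.v *)
Require Import Defs.
From HB Require Import structures.
From mathcomp Require Import all_boot all_algebra.
From mathcomp.multinomials Require Import ssrcomplements mpoly.
From mathcomp Require Import zify.
From Stdlib Require Import Classical_Prop IndefiniteDescription.

Set Implicit Arguments.
Unset Strict Implicit.
Unset Printing Implicit Defensive.

Import GRing.Theory.

Local Open Scope ring_scope.

(** Write [mshift x g] for [g(X + x)] and [apolar h p] for the pairing
    [\sum_m m! h_m p_m], that is [p(D)h] at the origin. By Taylor's formula
    [p(D)g(x) = apolar (mshift x g) p] ([mpoly_diffop_apolar]), and for this
    pairing differentiation is adjoint to multiplication by variables:
    [apolar h (D^a p) = apolar (X^a h) p] ([apolar_adjoint]). Hence the
    functionals [D^a p], for all [a], vanish at [g] exactly when the functional
    given by [p] at [x] vanishes on all multiples of [g]. In particular such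
    [g] form an ideal ([apolar_orthogonal_ideal]), which gives the direct
    implication.

    Conversely let [f] lie outside the ideal [I] of the [f_i]. Since the
    polynomial ring is Noetherian, some ideal [Q] containing [I] is maximal
    among the ideals that do not contain [f]. Then [Q : f] is a proper ideal;
    by the Nullstellensatz it has a zero [x], and the maximality of [Q] makes
    [Q : f] the whole maximal ideal of [x]. So each [X_j - x_j] carries [f]
    into [Q]; the ascending chain condition and once more the maximality of [Q]
    put a power of [X_j - x_j] in [Q] ([nilpotent_mod_max_avoiding]).
    Thus [Q] contains a power of the maximal ideal of [x]
    ([max_avoiding_primary]), the quotient by [Q] is finite dimensional, and
    some linear functional vanishes on [Q] but not at [f]. It only sees
    finitely many Taylor coefficients at [x], so in characteristic zero it has
    the form [g |-> p(D)g(x)] ([separating_apolar]); as it kills all multiples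
    of the [f_i], this [p] contradicts the assumption on [f].

    Taking [Q] rather than a primary component replaces the Krull intersection
    theorem by an elementary argument. The Nullstellensatz is proved by
    induction on the number of variables, after Arrondo: Nagata's substitution
    puts a monic polynomial into the ideal, and a determinant shows that a zero
    of the elimination ideal lifts. *)

(** * Ideals as predicates *)

Record is_ideal (R : comNzRingType) (J : R -> Prop) : Prop := IsIdeal {
  ideal0 : J 0;
  idealD : forall a b, J a -> J b -> J (a + b);
  idealM : forall a b, J b -> J (a * b) }.

Section Ideals.
Variable R : comNzRingType.
Implicit Types (J Q : R -> Prop) (A B : R -> Prop).

Lemma idealN J a : is_ideal J -> J a -> J (- a).
Proof. by move=> HJ Ja; rewrite -mulN1r; apply: idealM. Qed.

Lemma idealB J a b : is_ideal J -> J a -> J b -> J (a - b).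
Proof. by move=> HJ Ja Jb; apply: idealD => //; apply: idealN. Qed.

Lemma idealMr J a b : is_ideal J -> J a -> J (a * b).
Proof. by move=> HJ Ja; rewrite mulrC; apply: idealM. Qed.

Lemma ideal_sum J (I : Type) (r : seq I) (P : pred I) (E : I -> R) :
  is_ideal J -> (forall i, P i -> J (E i)) -> J (\sum_(i <- r | P i) E i).
Proof.
move=> HJ HE; apply: (big_ind J) => //; [exact: ideal0 | exact: idealD].
Qed.

Lemma ideal_preim (S : comNzRingType) (phi : {rmorphism S -> R}) J :
  is_ideal J -> is_ideal (fun a => J (phi a)).
Proof.
move=> HJ; split=> [|a b|a b]; first by rewrite rmorph0; apply: ideal0.
  by rewrite rmorphD; apply: idealD.
by rewrite rmorphM; apply: idealM.
Qed.

Lemma ideal_colon J y : is_ideal J -> is_ideal (fun b => J (y * b)).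
Proof.
move=> HJ; split=> [|a b|a b]; first by rewrite mulr0; apply: ideal0.
  by rewrite mulrDr; apply: idealD.
by rewrite mulrCA; apply: idealM.
Qed.

(** The ideal generated by [J] and [z]. *)
Lemma ideal_adjoin J z :
  is_ideal J -> is_ideal (fun w => exists c, J (w - c * z)).
Proof.
move=> HJ; split.
- by exists 0; rewrite mul0r subr0; apply: ideal0.
- move=> a b [c Hc] [d Hd]; exists (c + d).
  by rewrite mulrDl opprD addrACA; apply: idealD.
- move=> a b [c Hc]; exists (a * c).
  by rewrite -mulrA -mulrBr; apply: idealM.
Qed.

(** The intersection of all ideals containing [A]: members are used only
    through this universal property. *)
Definition ideal_gen A (f : R) : Prop :=
  forall J, is_ideal J -> (forall a, A a -> J a) -> J f.

Lemma ideal_gen_ideal A : is_ideal (ideal_gen A).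
Proof.
split=> [J HJ _|a b Ha Hb J HJ HA|a b Hb J HJ HA]; first exact: ideal0.
  by apply: idealD => //; [apply: Ha | apply: Hb].
by apply: idealM => //; apply: Hb.
Qed.

Lemma ideal_gen_mem A a : A a -> ideal_gen A a.
Proof. by move=> Aa J _; apply. Qed.

Lemma ideal_gen_mono A B f :
  (forall a, A a -> B a) -> ideal_gen A f -> ideal_gen B f.
Proof. by move=> AB Af J HJ HB; apply: Af => // a /AB/HB. Qed.

End Ideals.

Lemma in_gen_ideal_ideal (R : comNzRingType) s (F : 'I_s -> R) :
  is_ideal (in_gen_ideal F).
Proof.
split=> [|a b [g ->] [h ->]|a b [g ->]].
- by exists (fun=> 0); rewrite big1 // => i _; rewrite mul0r.
- exists (fun i => g i + h i); rewrite -big_split; apply: eq_bigr => i _.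
  by rewrite mulrDl.
- exists (fun i => a * g i); rewrite mulr_sumr; apply: eq_bigr => i _.
  by rewrite mulrA.
Qed.

Lemma in_gen_ideal_mem (R : comNzRingType) s (F : 'I_s -> R) i :
  in_gen_ideal F (F i).
Proof.
exists (fun j => (j == i)%:R); rewrite (bigD1 i) //= eqxx mul1r big1 ?addr0 //.
by move=> j /negPf->; rewrite mul0r.
Qed.

(** * Noetherian rings and Hilbert's basis theorem *)

(** The ascending chain condition in a form that speaks of elements only; it
    is classically equivalent to the usual one, by dependent choice. *)
Definition noetherian (R : comNzRingType) : Prop :=
  forall r : nat -> R,
  exists N, ideal_gen (fun z => exists2 i, (i < N)%N & z = r i) (r N).

(** Iterating the step and choosing a witness each time would give a sequence of
    elements [phi z], none in the ideal generated by its predecessors. The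
    invariant [P] and the map [phi] allow lists over another type [T]: Hilbert's
    theorem grows a list of polynomials and watches their leading
    coefficients. *)
Lemma noetherian_no_growing_list (R : comNzRingType) (T : eqType) (phi : T -> R)
    (P : seq T -> Prop) :
  noetherian R -> P [::] ->
  (forall s, P s -> exists z,
     ~ ideal_gen (fun a => a \in map phi s) (phi z) /\ P (rcons s z)) ->
  False.
Proof.
move=> noethR P0 step.
have [z0 _] := step _ P0.
have step' s : exists z, P s ->
    ~ ideal_gen (fun a => a \in map phi s) (phi z) /\ P (rcons s z).
  case: (classic (P s)) => [/step[z Hz]|nPs]; first by exists z.
  by exists z0.
pose nxt s := sval (constructive_indefinite_description _ (step' s)).
have nxtP s : P s -> ~ ideal_gen (fun a => a \in map phi s) (phi (nxt s)) /\
    P (rcons s (nxt s)).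
  exact: (svalP (constructive_indefinite_description _ (step' s))).
pose st N := iter N (fun s => rcons s (nxt s)) [::].
have Pst N : P (st N) by elim: N => //= N /nxtP[].
have st_mem N i : (i < N)%N -> nxt (st i) \in st N.
  elim: N => // N IH; rewrite ltnS leq_eqVlt /= mem_rcons inE.
  by case/predU1P => [->|/IH->]; rewrite ?eqxx ?orbT.
have [N HN] := noethR (fun i => phi (nxt (st i))).
case: (nxtP _ (Pst N)) => + _; apply.
by apply: ideal_gen_mono HN => _ [i ltiN ->]; apply: map_f; apply: st_mem.
Qed.

Lemma noetherian_ascending (R : comNzRingType) (J : nat -> R -> Prop) :
  noetherian R -> (forall i, is_ideal (J i)) ->
  (forall i a, J i a -> J i.+1 a) ->
  exists r, forall a, J r.+1 a -> J r a.
Proof.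
move=> noethR HJ incJ; apply: NNPP => no_stop.
have jump r : exists a, J r.+1 a /\ ~ J r a.
  apply: NNPP => no_a; apply: no_stop; exists r => a Ja.
  by apply: NNPP => nJa; apply: no_a; exists a.
pose z r := sval (constructive_indefinite_description _ (jump r)).
have zP r : J r.+1 (z r) /\ ~ J r (z r).
  exact: (svalP (constructive_indefinite_description _ (jump r))).
have [N HN] := noethR z; case: (zP N) => _; apply.
apply: HN => // _ [i ltiN ->].
rewrite -(subnK ltiN); elim: (N - _)%N => [|d IH]; first by case: (zP i).
by rewrite addSn; apply: incJ.
Qed.

Lemma noetherian_surj (R S : comNzRingType) (rho : {rmorphism R -> S})
    (theta : S -> R) :
  cancel theta rho -> noetherian R -> noetherian S.
Proof.
move=> thetaK noethR r; have [N HN] := noethR (theta \o r).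
exists N => J HJ Jr; rewrite -[r N]thetaK.
apply: (HN _ (ideal_preim rho HJ)) => _ [i ltiN ->] /=.
by rewrite thetaK; apply: Jr; exists i.
Qed.

Lemma noetherian_field (k : fieldType) : noetherian k.
Proof.
move=> r; have [r0|r0] := eqVneq (r 0%N) 0.
  by exists 0%N => J HJ _; rewrite r0; apply: ideal0.
exists 1%N => J HJ Jr; rewrite -[r 1%N](divfK r0); apply: idealM => //.
by apply: Jr; exists 0%N.
Qed.

Lemma ex_min_size (R : comNzRingType) (P : {poly R} -> Prop) :
  (exists p, P p) -> exists2 p, P p & forall q, P q -> (size p <= size q)%N.
Proof.
move=> [p Pp]; apply: NNPP => nomin.
have [m] := ubnP (size p); elim: m p Pp => // m IH p Pp ltpm.
apply: nomin; exists p => // q Pq; rewrite leqNgt; apply/negP => ltqp.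
by apply: (IH q) => //; apply: leq_trans ltqp _.
Qed.

(** Hilbert's argument: in an ideal [J] that is not finitely generated, keep
    adding to a finite list [s] an element [z] of least size in [J] outside the
    ideal of [s]. If the leading coefficient of [z] were in the ideal of those
    of [s], subtracting a combination of the [q * 'X^i], [q] in [s], would give
    an element of smaller size that is still outside the ideal of [s]. *)
Lemma hilbert_basis (R : comNzRingType) : noetherian R -> noetherian {poly R}.
Proof.
move=> noethR p; apply: NNPP => bad.
pose below N f := ideal_gen (fun z => exists2 i, (i < N)%N & z = p i) f.
pose J f := exists N, below N f.
have belowS N M f : (N <= M)%N -> below N f -> below M f.
  move=> leNM; apply: ideal_gen_mono => _ [i ltiN ->].
  by exists i => //; apply: leq_trans leNM.
have HJ : is_ideal J.
  split; first by exists 0%N; exact: (ideal0 (ideal_gen_ideal _)).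
    move=> a b [N Ha] [M Hb]; exists (maxn N M).
    apply: (idealD (ideal_gen_ideal _)).
      exact: belowS (leq_maxl _ _) Ha.
    exact: belowS (leq_maxr _ _) Hb.
  by move=> a b [N Hb]; exists N; exact: (idealM (ideal_gen_ideal _) _ Hb).
pose gen (s : seq {poly R}) := ideal_gen (fun a => a \in s).
have Jnfg s : (forall q, q \in s -> J q) -> exists z, J z /\ ~ gen s z.
  move=> Js; apply: NNPP => nz.
  have [N HN] : exists N, forall q, q \in s -> below N q.
    elim: s Js {nz} => [|q s IH] Js; first by exists 0%N.
    have [N HN] := IH (fun q' Hq' => Js q' (mem_behead (s := q :: s) Hq')).
    have [M HM] := Js q (mem_head _ _).
    exists (maxn N M) => q'; rewrite inE => /predU1P[->|/HN Hq'].
      exact: belowS (leq_maxr _ _) HM.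
    exact: belowS (leq_maxl _ _) Hq'.
  apply: bad; exists N.
  have JpN : J (p N).
    by exists N.+1; apply: ideal_gen_mem; exists N.
  have : gen s (p N) by apply: NNPP => ngen; apply: nz; exists (p N).
  by apply; [exact: ideal_gen_ideal | exact: HN].
pose minimal s := forall q, q \in s ->
  J q /\ forall z, J z -> ~ gen s z -> (size q <= size z)%N.
apply: (noetherian_no_growing_list (phi := lead_coef) (P := minimal) noethR)
  => // s Ps.
have [z [Jz nz] minz] :=
  ex_min_size (Jnfg s (fun q sq => proj1 (Ps q sq))).
exists z; split; last first.
  move=> q; rewrite mem_rcons inE => Hq.
  have nrcons y : ~ gen (rcons s z) y -> ~ gen s y.
    move=> + Hy; apply; apply: ideal_gen_mono Hy => a.
    by rewrite mem_rcons inE => ->; rewrite orbT.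
  case/predU1P: Hq => [->|sq]; first by split=> // y Jy /nrcons ny; apply: minz.
  by have [Jq minq] := Ps q sq; split=> // y Jy /nrcons; exact: minq.
have z_neq0 : z != 0.
  apply/eqP => z0; apply: nz; rewrite z0.
  exact: (ideal0 (ideal_gen_ideal _)).
move=> Hlead.
(* [L] is an ideal containing the leading coefficients of [s]: multiply by a
   power of 'X to reach the degree of [z]. *)
pose L c := exists2 h, gen s h & (size h <= size z)%N /\ h`_(size z).-1 = c.
have genI := ideal_gen_ideal (fun a => a \in s).
have [||h sh [szh hz]] := Hlead L.
- split.
  + by exists 0; [exact: (ideal0 genI) | rewrite size_poly0 coef0].
  + move=> a b [ha sha [sza <-]] [hb shb [szb <-]]; exists (ha + hb).
      exact: (idealD genI).
    by rewrite coefD (leq_trans (size_polyD _ _)) // geq_max sza szb.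
  + move=> a b [hb shb [szb <-]]; exists (a%:P * hb).
      exact: (idealM genI).
    rewrite coefCM; split=> //; rewrite mul_polyC.
    exact: leq_trans (size_scale_leq _ _) _.
- move=> _ /mapP[q sq ->]; have [Jq /(_ z Jz nz) leqz] := Ps q sq.
  exists ('X^(size z - size q) * q).
    by apply: (idealM genI); exact: ideal_gen_mem.
  rewrite mulrC; split.
    apply: leq_trans (size_polyMleq _ _) _; rewrite size_polyXn addnS /=.
    by rewrite subnKC.
  rewrite coefMXn.
  have [->|q0] := eqVneq q 0; first by rewrite coef0 lead_coef0 if_same.
  have szq : (0 < size q)%N by rewrite size_poly_gt0.
  case: ltnP => [|_]; first by lia.
  by rewrite lead_coefE; congr (q`_ _); lia.
have Jh : J h by apply: sh => // q /Ps[].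
suff : (size z <= size (z - h)%R)%N.
  rewrite leqNgt => /negP; apply.
  have szz : (0 < size z)%N by rewrite size_poly_gt0.
  rewrite -(prednK szz) ltnS; apply/leq_sizeP => j.
  rewrite leq_eqVlt coefB => /predU1P[<-|ltj]; first by rewrite hz subrr.
  have lezj : (size z <= j)%N by rewrite -(prednK szz).
  by rewrite !nth_default ?subrr // (leq_trans szh).
apply: minz; split; first exact: idealB.
by move=> szh'; apply: nz; rewrite -[z](subrK h); exact: (idealD genI).
Qed.

(** The conclusion says that [Q] is maximal among the ideals that do not
    contain [f]: if [z] is not in [Q], then [f] is in [Q + (z)]. *)
Lemma noetherian_max_avoiding (R : comNzRingType) (I : R -> Prop) (f : R) :
  noetherian R -> is_ideal I -> ~ I f ->
  exists Q : R -> Prop, [/\ is_ideal Q, forall a, I a -> Q a, ~ Q f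
    & forall z, ~ Q z -> exists c, Q (f - c * z)].
Proof.
move=> noethR HI nIf.
pose Q (s : seq R) := ideal_gen (fun a => I a \/ a \in s).
have QI s : is_ideal (Q s) by apply: ideal_gen_ideal.
have nQ0 : ~ Q [::] f by move=> Qf; apply: nIf; apply: Qf => // a [].
apply: NNPP => nomax.
apply: (noetherian_no_growing_list (phi := id) (P := fun s => ~ Q s f) noethR)
  => // s nQ.
apply: NNPP => nz; apply: nomax; exists (Q s); split=> //.
  by move=> a Ia; apply: ideal_gen_mem; left.
move=> z nQz; apply: NNPP => nc; apply: nz; exists z; split.
  move=> Hz; apply: nQz; apply: ideal_gen_mono Hz => a.
  by rewrite map_id; right.
move=> Qf; apply: nc; have adjI := ideal_adjoin z (QI s).
apply: (Qf _ adjI) => a [Ia|].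
  by exists 0; rewrite mul0r subr0; apply: ideal_gen_mem; left.
rewrite mem_rcons inE => /predU1P[->|sa].
  by exists 1; rewrite mul1r subrr; exact: (ideal0 (QI s)).
by exists 0; rewrite mul0r subr0; apply: ideal_gen_mem; right.
Qed.

(** The chain of the ideals [Q : y^r] stops at some [r]. If [y^r] were not in
    [Q], then [f = c y^r] modulo [Q]; multiplying by [y] puts [c y^(r+1)] in
    [Q], hence [c y^r] in [Q] as the chain has stopped, hence [f] in [Q]. *)
Lemma nilpotent_mod_max_avoiding (R : comNzRingType) (Q : R -> Prop)
    (f y : R) :
  noetherian R -> is_ideal Q -> ~ Q f ->
  (forall z, ~ Q z -> exists c, Q (f - c * z)) ->
  Q (y * f) -> exists r, Q (y ^+ r).
Proof.
move=> noethR HQ nQf maxQ Qyf.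
have [|i a Qa|r stopQ] :=
    noetherian_ascending (J := fun r b => Q (y ^+ r * b)) noethR.
- by move=> r; apply: ideal_colon.
- by rewrite exprS -mulrA; apply: idealM.
exists r; apply: NNPP => nQyr; have [c Qc] := maxQ _ nQyr.
apply: nQf; rewrite -[f](subrK (c * y ^+ r)); apply: idealD => //.
rewrite mulrC; apply: stopQ.
have -> : y ^+ r.+1 * c = y * f - y * (f - c * y ^+ r).
  by rewrite mulrBr opprB addrCA subrr addr0 exprS mulrCA mulrC.
by apply: idealB => //; apply: idealM.
Qed.

(** * Polynomials in one more variable *)

Lemma mpoly_ring_ind n (R : comNzRingType) (P : {mpoly R[n]} -> Prop) :
  (forall c, P c%:MP) -> (forall i, P 'X_i) ->
  (forall p q, P p -> P q -> P (p + q)) ->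
  (forall p q, P p -> P q -> P (p * q)) -> forall p, P p.
Proof.
move=> PC PX PD PM p; rewrite [p]mpolyE.
have P0 : P 0 by rewrite -mpolyC0.
have P1 : P 1 by rewrite -mpolyC1.
apply: (big_ind P) => // m _; rewrite -mul_mpolyC mpolyXE_id; apply: (PM) => //.
apply: (big_ind P) => // i _; elim: (m i) => [|e IH]; first by rewrite expr0.
by rewrite exprS; apply: (PM).
Qed.

Lemma mpoly_rmorph_ext n (R : comNzRingType) (S : nzRingType)
    (phi psi : {rmorphism {mpoly R[n]} -> S}) :
  (forall c, phi c%:MP = psi c%:MP) -> (forall i, phi 'X_i = psi 'X_i) ->
  phi =1 psi.
Proof.
move=> eqC eqX; elim/mpoly_ring_ind => // p q IHp IHq.
  by rewrite !rmorphD IHp IHq.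
by rewrite !rmorphM IHp IHq.
Qed.

(** [theta] is an isomorphism with inverse [rho]: it isolates the first variable
    after the triangular substitution [X_(i+1) |-> X_(i+1) + X_0 ^ (D ^ (i+1))].
    Only [cancel theta rho] is recorded, since an ideal is transported along
    [rho] by taking its preimage. *)
Lemma nagata_substitution (k : comNzRingType) n D :
  exists (theta : {rmorphism {mpoly k[n.+1]} -> {poly {mpoly k[n]}}})
         (rho : {rmorphism {poly {mpoly k[n]}} -> {mpoly k[n.+1]}}),
  [/\ cancel theta rho, forall c, theta c%:MP = c%:MP%:P, theta 'X_ord0 = 'X
    & forall i, theta 'X_(lift ord0 i) = ('X_i)%:P + 'X^(D ^ i.+1)].
Proof.
pose h (j : 'I_n.+1) : {poly {mpoly k[n]}} :=
  if unlift ord0 j is Some i then ('X_i)%:P + 'X^(D ^ i.+1) else 'X.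
pose theta : {rmorphism {mpoly k[n.+1]} -> {poly {mpoly k[n]}}} :=
  mmap (polyC \o @mpolyC n k) h.
pose sigma : {rmorphism {mpoly k[n]} -> {mpoly k[n.+1]}} :=
  mmap (@mpolyC n.+1 k) (fun i => 'X_(lift ord0 i) - 'X_ord0 ^+ (D ^ i.+1)).
pose rho : {rmorphism {poly {mpoly k[n]}} -> {mpoly k[n.+1]}} :=
  horner_eval ('X_ord0 : {mpoly k[n.+1]}) \o map_poly sigma.
have rhoC q : rho q%:P = sigma q.
  by rewrite /= map_polyC /= /horner_eval hornerC.
have rhoX : rho 'X = 'X_ord0 by rewrite /= map_polyX /horner_eval hornerX.
have thetaC c : theta c%:MP = c%:MP%:P by rewrite /= mmapC.
have theta0 : theta 'X_ord0 = 'X by rewrite /= mmapX mmap1U /h unlift_none.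
have thetaS i : theta 'X_(lift ord0 i) = ('X_i)%:P + 'X^(D ^ i.+1).
  by rewrite /= mmapX mmap1U /h liftK.
exists theta, rho; split=> //.
apply: (@mpoly_rmorph_ext _ _ _ (rho \o theta) idfun) => [c|i].
  by rewrite -[LHS]/(rho (theta _)) thetaC rhoC /= mmapC.
rewrite -[LHS]/(rho (theta _)).
case: (unliftP ord0 i) => [j|] ->; last by rewrite theta0 rhoX.
by rewrite thetaS rmorphD rmorphXn rhoC rhoX /= mmapX mmap1U subrK.
Qed.

Lemma noetherian_mpoly (k : fieldType) n : noetherian {mpoly k[n]}.
Proof.
elim: n => [|n IH].
  apply: (noetherian_surj (rho := @mpolyC 0 k) (@mpolyKC k)).
  exact: noetherian_field.
(* Only the surjection onto the ring in [n.+1] variables matters: the base 0 of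
   the exponents is arbitrary. *)
have [theta [rho [thetaK _ _ _]]] := nagata_substitution k n 0.
exact: (noetherian_surj thetaK (hilbert_basis IH)).
Qed.

(** * The weak Nullstellensatz *)

Lemma base_expansion_inj n D (a b : 'I_n -> nat) :
  (forall i, a i < D)%N -> (forall i, b i < D)%N ->
  (\sum_(i < n) a i * D ^ i = \sum_(i < n) b i * D ^ i)%N -> a =1 b.
Proof.
elim: n a b => [|n IH] a b ltaD ltbD; first by move=> _ [].
have D_gt0 : (0 < D)%N by apply: leq_ltn_trans (ltaD ord0).
have shift (c : 'I_n.+1 -> nat) : (\sum_(i < n.+1) c i * D ^ i =
    (\sum_(i < n) c (lift ord0 i) * D ^ i) * D + c ord0)%N.
  rewrite big_ord_recl expn0 muln1 addnC big_distrl /=; congr addn.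
  by apply: eq_bigr => i _; rewrite /bump /= add1n expnSr mulnA.
rewrite !shift => eqab.
have eq0 : a ord0 = b ord0.
  by move/(congr1 (modn^~ D)): eqab; rewrite !modnMDl !modn_small.
have eqS : (fun i => a (lift ord0 i)) =1 (fun i => b (lift ord0 i)).
  apply: IH => //; apply/eqP; rewrite -(eqn_pmul2r D_gt0).
  by move/eqP: eqab; rewrite eq0 eqn_add2r.
by move=> i; case: (unliftP ord0 i) => [j|] ->.
Qed.

(** The image of ['X_[m]] is monic in the main variable, of degree
    [\sum_j m_j D^j]. When [D] exceeds all exponents these degrees are distinct
    for distinct [m], so the top one cannot cancel and its coefficient in [g], a
    constant, is the leading coefficient. *)
Lemma nagata_lead (k : comNzRingType) n D
    (theta : {rmorphism {mpoly k[n.+1]} -> {poly {mpoly k[n]}}})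
    (g : {mpoly k[n.+1]}) :
  (forall c, theta c%:MP = c%:MP%:P) -> theta 'X_ord0 = 'X ->
  (forall i, theta 'X_(lift ord0 i) = ('X_i)%:P + 'X^(D ^ i.+1)) ->
  g != 0 -> (msize g <= D)%N ->
  exists2 m, g@_m != 0 & lead_coef (theta g) = (g@_m)%:MP.
Proof.
move=> thetaC theta0 thetaS g0 leD.
have D_gt0 : (0 < D)%N by apply: leq_trans leD; rewrite mpolySpred.
pose has_deg (p : {poly {mpoly k[n]}}) d := p \is monic /\ size p = d.+1.
have deg1 : has_deg 1 0%N by split; rewrite ?monic1 ?size_poly1.
have degM p q d e : has_deg p d -> has_deg q e -> has_deg (p * q) (d + e)%N.
  move=> [mp sp] [mq sq]; split; first exact: rpredM.
  by rewrite size_Mmonic ?monic_neq0 // sp sq addnS.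
have degX p d e : has_deg p d -> has_deg (p ^+ e) (e * d)%N.
  by move=> Hp; elim: e => // e IH; rewrite exprS mulSn; apply: degM.
have degv (j : 'I_n.+1) : has_deg (theta 'X_j) (D ^ j)%N.
  case: (unliftP ord0 j) => [i|] ->; last first.
    by rewrite theta0; split; rewrite ?monicX ?size_polyX.
  pose e := (D ^ i.+1)%N.
  have lt : (size (('X_i : {mpoly k[n]})%:P) <
             size ('X^e : {poly {mpoly k[n]}}))%N.
    rewrite size_polyXn ltnS (leq_trans (size_polyC_leq1 _)) //.
    by rewrite expn_gt0 D_gt0.
  rewrite thetaS -/e.
  split; first by rewrite monicE lead_coefDr // lead_coefXn.
  by rewrite addrC size_polyDl // size_polyXn.
pose wt (m : 'X_{1..n.+1}) := (\sum_(j < n.+1) m j * D ^ j)%N.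
have degm m : has_deg (theta 'X_[m]) (wt m).
  rewrite mpolyXE_id rmorph_prod /wt.
  apply: (big_ind2 has_deg) => // [p d q e|j _].
    exact: degM.
  by rewrite rmorphXn; apply: degX.
have wt_inj : {in msupp g &, injective wt}.
  move=> m m' /msize_mdeg_lt ltm /msize_mdeg_lt ltm' eqw; apply/mnmP.
  have small (l : 'X_{1..n.+1}) : (mdeg l < msize g)%N -> forall i, (l i < D)%N.
    move=> ltl i; apply: leq_trans leD; apply: leq_ltn_trans ltl.
    by rewrite mdegE (bigD1 i) //= leq_addr.
  by apply: (base_expansion_inj (D := D)) => //; apply: small.
have [m gm maxm] : exists2 m, m \in msupp g &
    forall m', m' \in msupp g -> (wt m' <= wt m)%N.
  have /hasP[m0 m0g _] : has predT (msupp g).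
    by rewrite has_predT lt0n size_eq0 msupp_eq0.
  have exd : exists d, has (fun m => wt m == d) (msupp g).
    by exists (wt m0); apply/hasP; exists m0.
  have bnd d : has (fun m => wt m == d) (msupp g) ->
      (d <= \max_(m <- msupp g) wt m)%N.
    by case/hasP => m gm /eqP <-; rewrite (big_rem m) //= leq_maxl.
  case: (ex_maxnP exd bnd) => d /hasP[m gm /eqP wtm] maxd.
  by exists m => // m' gm'; rewrite wtm; apply: maxd; apply/hasP; exists m'.
exists m; first by rewrite -mcoeff_msupp.
have thetaZ c p : theta (c *: p) = c%:MP *: theta p.
  by rewrite -mul_mpolyC rmorphM thetaC mul_polyC.
have gE : theta g = \sum_(m' <- msupp g) (g@_m')%:MP *: theta 'X_[m'].
  rewrite {1}[g]mpolyE rmorph_sum; apply: eq_bigr => m' _; exact: thetaZ.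
have szle : (size (theta g) <= (wt m).+1)%N.
  rewrite gE; apply: (leq_trans (size_sum _ _ _)).
  apply/bigmax_leqP_seq => m' gm' _; apply: leq_trans (size_scale_leq _ _) _.
  by case: (degm m') => _ ->; rewrite ltnS maxm.
have cf : (theta g)`_(wt m) = (g@_m)%:MP.
  rewrite gE coef_sum (bigD1_seq m) ?msupp_uniq //= coefZ.
  have [/monicP + sz] := degm m; rewrite lead_coefE sz /= => ->.
  rewrite mulr1 big_seq_cond big1 ?addr0 // => m' /andP[gm' m'm].
  rewrite coefZ nth_default ?mulr0 //; case: (degm m') => _ ->.
  rewrite ltn_neqAle maxm // andbT; apply: contraNneq m'm => /wt_inj -> //.
rewrite lead_coefE -cf; congr (_`_ _).
apply/eqP; rewrite eq_sym -eqSS prednK ?eqn_leq ?szle ?andbT.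
  rewrite ltnNge; apply/negP => /leq_sizeP/(_ _ (leqnn _)).
  by rewrite cf => /eqP; rewrite mpolyC_eq0 mcoeff_eq0 gm.
rewrite lt0n size_poly_eq0; apply: contraTneq gm => g00.
by move: cf; rewrite g00 coef0 => /esym/eqP; rewrite mpolyC_eq0 mcoeff_eq0.
Qed.

(** Let [M] be the matrix of the multiplication by [g] in the basis of powers of
    ['X] modulo the monic [h], and [v] the column of these powers. As [g] and [h]
    are in [J], so are the entries of [M v]; multiplying by the adjugate of [M]
    puts [det M * 'X^0] in [J], so that [ev (det M) = 0]. But if [ev] maps [g] to
    [1], it maps [M] to the identity matrix. *)
Lemma fibre_ideal_proper (A k : comNzRingType) (ev : {rmorphism A -> k})
    (J : {poly A} -> Prop) (h g : {poly A}) :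
  is_ideal J -> (forall u, J u%:P -> ev u = 0) -> J h -> h \is monic ->
  J g -> map_poly ev g <> 1.
Proof.
move=> HJ J0 Jh hmon Jg evg.
have : size h != 0%N by rewrite size_poly_eq0 monic_neq0.
(* The matrix has size [d.+1]; the case of a constant [h] is apart because the
   power 'X^0 must be one of the basis elements. *)
case szh: (size h) => [//|[|d]] _.
  have h1 : h = 1.
    have /size_poly1P[c _ hE] : size h == 1%N by rewrite szh.
    by move/monicP: hmon; rewrite hE lead_coefC => ->.
  have /J0/eqP : J 1%:P by rewrite polyC1 -h1.
  by rewrite rmorph1 oner_eq0.
pose r i := Pdiv.Ring.rmodp ('X^i * g) h.
have szr i : (size (r i) < d.+2)%N.
  by rewrite -szh Pdiv.Ring.ltn_rmodpN0 ?monic_neq0.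
have rE i : 'X^i * g = Pdiv.Ring.rdivp ('X^i * g) h * h + r i.
  exact: Pdiv.RingMonic.rdivp_eq.
have Jr i : J (r i).
  have -> : r i = 'X^i * g - Pdiv.Ring.rdivp ('X^i * g) h * h.
    by rewrite {1}rE addrC addKr.
  by apply: idealB => //; apply: idealM.
pose M : 'M[A]_d.+1 := \matrix_(i, j) (r i)`_j.
pose v : 'cV[{poly A}]_d.+1 := \col_j 'X^j.
have detM : \det (map_mx ev M) = 1.
  suff -> : map_mx ev M = 1%:M by rewrite det1.
  apply/matrixP => i j; rewrite !mxE -coef_map.
  have hmon' : map_poly ev h \is monic by apply: monic_map.
  have szh' : size (map_poly ev h) = d.+2.
    by rewrite size_map_poly_id0 ?szh // (monicP hmon) rmorph1 oner_eq0.
  have := congr1 (map_poly ev) (rE i).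
  rewrite rmorphD !rmorphM /= evg mulr1 map_polyXn => eqX.
  have : Pdiv.Ring.rmodp ('X^i : {poly k}) (map_poly ev h) = map_poly ev (r i).
    rewrite eqX; apply: Pdiv.RingMonic.rmodp_addl_mul_small => //.
    by rewrite szh'; apply: leq_ltn_trans (size_poly _ _) (szr i).
  rewrite Pdiv.Ring.rmodp_small => [<-|]; last first.
    by rewrite size_polyXn szh' ltnS ltn_ord.
  by rewrite coefXn eq_sym.
have JdetM : J (\det M)%:P.
  have : (\adj (map_mx polyC M) *m (map_mx polyC M *m v)) ord0 ord0 =
      (\det M)%:P.
    by rewrite mulmxA mul_adj_mx mul_scalar_mx mxE mxE expr0 mulr1 det_map_mx.
  move=> <-; rewrite mxE; apply: ideal_sum => // i _; apply: idealM => //.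
  have -> // : (map_mx polyC M *m v) i ord0 = r i.
  rewrite mxE -[RHS]coefK (@poly_def _ _ _).
  rewrite (big_ord_widen d.+1 (fun j => (r i)`_j *: 'X^j)) //; last exact: szr.
  rewrite [RHS]big_mkcond; apply: eq_bigr => j _; rewrite !mxE mul_polyC.
  by case: ltnP => // lej; rewrite nth_default // scale0r.
by move/J0/eqP: JdetM; rewrite -det_map_mx detM oner_eq0.
Qed.

Lemma closed_ideal_root (k : closedFieldType) (E : {poly k} -> Prop) :
  is_ideal E -> ~ E 1 -> exists t, forall q, E q -> root q t.
Proof.
move=> HE nE1.
case: (classic (exists q, E q /\ q != 0)) => [/ex_min_size|no_q]; last first.
  exists 0 => q Eq; have [->|q0] := eqVneq q 0; first exact: root0.
  by case: no_q; exists q.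
case=> d [Ed d0] mind.
have /closed_rootP[t rt] : size d != 1%N.
  apply/negP => /size_poly1P[c c0 dE]; apply: nE1.
  rewrite -(_ : c^-1%:P * d = 1); first exact: idealM.
  by rewrite dE -polyCM mulVf.
exists t => q Eq; move: rt; rewrite -!dvdp_XsubCl => /dvdp_trans; apply.
apply/eqP; apply: NNPP => /eqP r0.
have /mind : E (q %% d) /\ q %% d != 0.
  split=> //; rewrite -[q %% d](addKr (q %/ d * d)) -divp_eq addrC.
  by apply: idealB => //; apply: idealM.
by rewrite leqNgt ltn_modp d0.
Qed.

(** Once Nagata's substitution has put a monic polynomial in the ideal, the
    elimination ideal has a zero [a] by induction, and the specialization at
    [a] is a proper ideal of [{poly k}], which has a root. *)
Theorem weak_nullstellensatz (k : closedFieldType) n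
    (J : {mpoly k[n]} -> Prop) :
  is_ideal J -> ~ J 1 -> exists x, forall g, J g -> g.@[x] = 0.
Proof.
elim: n J => [|n IH] J HJ nJ1.
  exists (fun=> 0) => g Jg; rewrite [g]nvar0_mpolyC mevalC.
  apply: NNPP => /eqP c0; apply: nJ1.
  rewrite -mpolyC1 -(mulVf c0) mpolyCM -nvar0_mpolyC.
  exact: idealM.
case: (classic (exists g, J g /\ g != 0)) => [[g [Jg g0]]|no_g]; last first.
  exists (fun=> 0) => g Jg; have [->|g0] := eqVneq g 0; first exact: meval0.
  by case: no_g; exists g.
have [theta [rho [thetaK thetaC theta0 thetaS]]] :=
  nagata_substitution k n (msize g).
have [m gm0 leadg] := nagata_lead thetaC theta0 thetaS g0 (leqnn _).
pose J' q := J (rho q).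
have HJ' : is_ideal J' := ideal_preim rho HJ.
have thetaJ' q : J q -> J' (theta q) by rewrite /J' thetaK.
pose h := theta ((g@_m)^-1 *: g).
have J'h : J' h by apply: thetaJ'; rewrite -mul_mpolyC; apply: idealM.
have hmon : h \is monic.
  rewrite monicE /h -mul_mpolyC rmorphM thetaC mul_polyC lead_coefZ leadg.
  by rewrite -mpolyCM mulVf.
have [a a0] : exists a, forall u, J' u%:P -> u.@[a] = 0.
  apply: (IH (fun u => J' u%:P)); first exact: (ideal_preim polyC HJ').
  by rewrite /J' polyC1 rmorph1.
pose E q := exists2 q', J' q' & map_poly (meval a) q' = q.
have HE : is_ideal E.
  split; first by exists 0; [exact: ideal0 | rewrite rmorph0].
    move=> _ _ [p Jp <-] [q Jq <-]; exists (p + q); first exact: idealD.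
    by rewrite rmorphD.
  move=> p _ [q Jq <-]; exists (map_poly (@mpolyC n k) p * q).
    exact: idealM.
  rewrite rmorphM /=; congr (_ * _).
  by apply/polyP => i; rewrite !coef_map /= mevalC.
have nE1 : ~ E 1.
  by case=> q Jq; apply: (fibre_ideal_proper HJ' a0 J'h hmon Jq).
have [t rt] := closed_ideal_root HE nE1.
exists (fun j => (map_poly (meval a) (theta 'X_j)).[t]) => q Jq.
transitivity (map_poly (meval a) (theta q)).[t]; last first.
  by apply/eqP/rt; exists (theta q) => //; apply: thetaJ'.
apply: (@mpoly_rmorph_ext _ _ _ (meval _)
  (horner_eval t \o (map_poly (meval a) \o theta))) => [c|j] /=.
  by rewrite mevalC thetaC map_polyC /= mevalC /horner_eval hornerC.
by rewrite mevalXU.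
Qed.

(** * Taylor coefficients and the apolar pairing *)

Definition mfact n (m : 'X_{1..n}) : nat := (\prod_(i < n) (m i)`!)%N.

Lemma mnm_ind n (P : 'X_{1..n} -> Prop) :
  P 0%MM -> (forall i m, P m -> P (U_(i) + m)%MM) -> forall m, P m.
Proof.
move=> P0 PS m; have [d] := ubnP (mdeg m); elim: d m => // d IH m ltmd.
have [->//|m0] := eqVneq m 0%MM.
have /existsP[i mi0] : [exists i, m i != 0%N].
  apply: contraNT m0; rewrite negb_exists => /forallP m0.
  by apply/eqP/mnmP => i; rewrite mnm0E; apply/eqP; move: (m0 i); rewrite negbK.
have leim : (U_(i) <= m)%MM by rewrite lep1mP.
rewrite -(submK leim) addmC; apply: PS; apply: IH.
rewrite -ltnS; apply: leq_trans ltmd.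
by rewrite -{2}(submK leim) mdegD mdeg1 addn1.
Qed.

Section Translation.
Variables (k : comNzRingType) (n : nat).
Implicit Types (x : 'I_n -> k) (g h p : {mpoly k[n]}).

(** [g(X + x)], whose coefficients are the Taylor coefficients of [g] at [x]. *)
Definition mshift x g : {mpoly k[n]} :=
  mmap (@mpolyC n k) (fun i => 'X_i + (x i)%:MP) g.

HB.instance Definition _ x := GRing.RMorphism.copy (mshift x)
  (mmap (@mpolyC n k) (fun i => 'X_i + (x i)%:MP)).

Lemma mshiftC x c : mshift x c%:MP = c%:MP.
Proof. by rewrite /mshift mmapC. Qed.

Lemma mshiftX x i : mshift x 'X_i = 'X_i + (x i)%:MP.
Proof. by rewrite /mshift mmapX mmap1U. Qed.

Lemma mshiftK x : cancel (mshift x) (mshift (fun i => - x i)).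
Proof.
apply: (@mpoly_rmorph_ext _ _ _ (mshift (fun i => - x i) \o mshift x) idfun).
  by move=> c /=; rewrite !mshiftC.
by move=> i /=; rewrite mshiftX rmorphD /= mshiftX mshiftC mpolyCN subrK.
Qed.

Lemma mcoeff0_mshift x g : (mshift x g)@_0%MM = g.@[x].
Proof.
apply: (@mpoly_rmorph_ext _ _ _ (mcoeff 0%MM \o mshift x) (meval x)).
  by move=> c /=; rewrite mshiftC mcoeffC eqxx mulr1 mevalC.
move=> i /=; rewrite mshiftX mevalXU mcoeffD mcoeffX mcoeffC eqxx mulr1.
by rewrite -mdeg_eq0 mdeg1 add0r.
Qed.

Lemma mderiv_mshift x i g : mshift x g^`M(i) = (mshift x g)^`M(i).
Proof.
elim/mpoly_ring_ind: g => [c|j|g h IHg IHh|g h IHg IHh].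
- by rewrite mshiftC !mderivC rmorph0.
- rewrite mshiftX mderivD mderivC addr0 mderivX -mul_mpolyC rmorphM /= mshiftC.
  rewrite !mul_mpolyC mnm1E; have [->|_] := eqVneq j i.
    2: by rewrite !scale0r.
  have -> : (U_(i) - U_(i))%MM = 0%MM :> 'X_{1..n}.
    by apply/mnmP => l; rewrite mnmBE subnn mnm0E.
  rewrite mpolyX0; congr (_ *: _); exact: rmorph1.
- by rewrite mderivD !rmorphD mderivD /= IHg IHh.
- by rewrite mderivM rmorphD !rmorphM mderivM /= IHg IHh.
Qed.

Lemma mderivm_mshift x m g : mshift x g^`M[m] = (mshift x g)^`M[m].
Proof.
elim/mnm_ind: m g => [|i m IH] g; first by rewrite !mderivm0m.
by rewrite !mderivmDm !mderivmU1m IH mderiv_mshift.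
Qed.

Lemma taylor_coeff x m g : g^`M[m].@[x] = (mshift x g)@_m *+ mfact m.
Proof.
rewrite -mcoeff0_mshift mderivm_mshift mcoeff_mderivm addm0.
by congr (_ *+ _); apply: eq_bigr => i _; rewrite ffactnn.
Qed.

(** The apolar (Fischer) pairing, [p(D)h] evaluated at the origin. *)
Definition apolar h p : k := \sum_(m <- msupp p) p@_m * (h@_m *+ mfact m).

Lemma mpoly_diffop_apolar x p g :
  (mpoly_diffop p g).@[x] = apolar (mshift x g) p.
Proof.
rewrite /mpoly_diffop rmorph_sum; apply: eq_bigr => m _ /=.
by rewrite mevalZ taylor_coeff.
Qed.

Lemma apolarwE h p d : (msize p <= d)%N ->
  apolar h p = \sum_(m : 'X_{1..n < d}) p@_m * (h@_m *+ mfact m).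
Proof.
move=> led; pose I : subFinType _ := 'X_{1..n < d}.
rewrite /apolar (big_mksub I) ?msupp_uniq //=; last first.
  by move=> m /msize_mdeg_lt /leq_trans; apply.
by rewrite big_rmcond //= => m /memN_msupp_eq0 ->; rewrite mul0r.
Qed.

Lemma apolar_is_linear h : scalar (apolar h).
Proof.
move=> c p q; set d := maxn (msize p) (msize q).
rewrite !(@apolarwE h _ d) ?leq_maxl ?leq_maxr //; last first.
  apply: leq_trans (msizeD_le _ _) _; rewrite geq_max leq_maxr andbT.
  exact: leq_trans (msizeZ_le _ _) (leq_maxl _ _).
rewrite mulr_sumr -big_split; apply: eq_bigr => m _ /=.
by rewrite mcoeffD mcoeffZ mulrDl mulrA.
Qed.

HB.instance Definition _ h :=
  GRing.isLinear.Build k {mpoly k[n]} k _ (apolar h) (apolar_is_linear h).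

Lemma apolarX h m : apolar h 'X_[m] = h@_m *+ mfact m.
Proof. by rewrite /apolar msuppX big_seq1 mcoeffX eqxx mul1r. Qed.

Lemma apolarDl h1 h2 p : apolar (h1 + h2) p = apolar h1 p + apolar h2 p.
Proof.
rewrite /apolar -big_split; apply: eq_bigr => m _ /=.
by rewrite mcoeffD mulrnDl mulrDr.
Qed.

Lemma apolarZl c h p : apolar (c *: h) p = c * apolar h p.
Proof.
rewrite /apolar mulr_sumr; apply: eq_bigr => m _ /=.
by rewrite mcoeffZ -mulrnAr mulrCA.
Qed.

(** By linearity in [p], the case of a monomial ['X_[m]] is enough: both sides
    are [m! h_(m - a)] when [a <= m], and zero otherwise. *)
Lemma apolar_adjoint a h p : apolar h p^`M[a] = apolar ('X_[a] * h) p.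
Proof.
rewrite [p]mpolyE !linear_sum; apply: eq_bigr => m _ /=.
rewrite !linearZ /=; congr (_ * _); rewrite mderivmX scaler_nat.
rewrite raddfMn /= !apolarX; case lea: (a <= m)%MM.
  have -> : ('X_[a] * h)@_m = h@_(m - a).
    by rewrite mulrC -{1}(submK lea) addmC mcoeffMX.
  rewrite -mulrnA /mfact -big_split; congr (_ *+ _); apply: eq_bigr => i _ /=.
  by rewrite mnmBE mulnC ffact_fact //; apply: (mnm_lepP lea).
have [i lti] : exists i, (m i < a i)%N.
  move/negbT/mnm_lepP: lea => nle; apply/existsP; apply: contraT.
  rewrite negb_exists => /forallP Hi; case: nle => i.
  by rewrite leqNgt; apply: Hi.
rewrite (bigD1 i) //= ffact_small // mul0n mulr0n.
rewrite (_ : _@__ = 0) ?mul0rn //; apply: memN_msupp_eq0.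
rewrite mulrC (perm_mem (msuppMX _ _)); apply/mapP => -[m' _ mE].
by move: lea; rewrite mE lem_addr.
Qed.

End Translation.

(** * Separation by a linear functional *)

(** [U] is only a predicate; a matrix of maximal rank with rows in [U] has row
    space [U], and its cokernel provides the functional. *)
Lemma separating_functional (k : fieldType) d (U : 'rV[k]_d -> Prop) v :
  U 0 -> (forall c u w, U u -> U w -> U (c *: u + w)) -> ~ U v ->
  exists2 w : 'cV[k]_d, forall u, U u -> u *m w = 0 & v *m w != 0.
Proof.
move=> U0 UL nUv.
have Usum (I : Type) (r : seq I) (c : I -> k) (E : I -> 'rV[k]_d) :
    (forall i, U (E i)) -> U (\sum_(i <- r) c i *: E i).
  by move=> UE; elim: r => [|i r IH]; rewrite ?big_nil ?big_cons //; apply: UL.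
have Urow m (A : 'M[k]_(m, d)) u :
    (forall i, U (row i A)) -> (u <= A)%MS -> U u.
  by move=> UA /submxP[D ->]; rewrite mulmx_sum_row; apply: Usum.
have [A UA maxA] : exists2 A : 'M[k]_d, forall i, U (row i A) &
    forall B : 'M[k]_d, (forall i, U (row i B)) -> (\rank B <= \rank A)%N.
  apply: NNPP => nomax.
  suff /(_ d.+1)[A _] : forall r, exists2 A : 'M[k]_d,
      forall i, U (row i A) & (r <= \rank A)%N.
    by rewrite ltnNge rank_leq_row.
  elim=> [|r [A UA lerA]]; first by exists 0 => // i; rewrite row0.
  apply: NNPP => noB; apply: nomax; exists A => // B UB.
  rewrite leqNgt; apply/negP => ltAB; apply: noB; exists B => //.
  exact: leq_ltn_trans ltAB.
have UsubA u : U u -> (u <= A)%MS.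
  move=> Uu.
  have UAu i : U (row i (A + u)%MS).
    have /sub_addsmxP[[D E] ->] := row_sub i (A + u)%MS.
    rewrite -[D *m A]scale1r; apply: UL.
      by apply: (Urow _ A) => //; rewrite submxMl.
    by apply: (Urow _ u) => [j|]; rewrite ?submxMl // (row_id j).
  rewrite (submx_trans (addsmxSr A u)) //.
  by rewrite -(geq_leqif (mxrank_leqif_sup (addsmxSl A u))) maxA.
have nvA : v *m cokermx A != 0.
  by rewrite -submxE; apply/negP => /(Urow _ _ _ UA).
have [j vj] : exists j, col j (v *m cokermx A) != 0.
  apply/existsP; apply: contraNT nvA; rewrite negb_exists => /forallP c0.
  apply/eqP/matrixP => i j; have := c0 j; rewrite negbK => /eqP/colP/(_ i).
  by rewrite !mxE.
exists (col j (cokermx A)) => [u /UsubA|]; last by rewrite colE mulmxA -colE.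
by rewrite submxE => /eqP uA0; rewrite colE mulmxA uA0 mul0mx.
Qed.

(** Membership in [Q] only depends on the coefficients of degree less than [N],
    so a functional vanishing on [Q] and not at [h0] is a combination of these
    coefficients. Characteristic zero allows one to divide by the [m!] of the
    pairing and so to read it as [apolar _ p]. *)
Lemma separating_apolar (k : fieldType) (hk : [pchar k] =i pred0) n N
    (Q : {mpoly k[n]} -> Prop) h0 :
  is_ideal Q -> (forall m, (N <= mdeg m)%N -> Q 'X_[m]) -> ~ Q h0 ->
  exists2 p, forall h, Q h -> apolar h p = 0 & apolar h0 p != 0.
Proof.
move=> HQ Qhigh nQ0.
have QZ c h : Q h -> Q (c *: h) by rewrite -mul_mpolyC; apply: idealM.
pose T : finType := 'X_{1..n < N}.
pose trunc (u : 'rV[k]_#|T|) : {mpoly k[n]} :=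
  \sum_(m : T) u ord0 (enum_rank m) *: 'X_[m].
pose vec (h : {mpoly k[n]}) : 'rV[k]_#|T| := \row_i h@_(enum_val i : T).
have Qtail h : Q (h - trunc (vec h)).
  rewrite [X in Q X]mpolyE big_seq; apply: ideal_sum => // m.
  rewrite mcoeff_msupp => hm.
  apply: QZ; apply: Qhigh; rewrite leqNgt; apply: contra hm => ltm.
  rewrite mcoeffB /trunc; under eq_bigr do rewrite mxE enum_rankK.
  by rewrite (mcoeff_mpoly (fun m => h@_m)) // subrr.
have Qtrunc h : Q (trunc (vec h)) <-> Q h.
  split=> Qh; last by rewrite -[trunc _](subKr h); apply: idealB.
  by rewrite -[h](subrK (trunc (vec h))); apply: idealD.
have trL c u w : trunc (c *: u + w) = c *: trunc u + trunc w.
  rewrite /trunc scaler_sumr -big_split; apply: eq_bigr => m _ /=.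
  by rewrite !mxE scalerDl scalerA.
have tr0 : trunc 0 = 0.
  by rewrite /trunc big1 // => m _; rewrite mxE scale0r.
have [|c u w Qu Qw||w wQ wh0] :=
    separating_functional (U := fun u => Q (trunc u)) (v := vec h0).
- by rewrite tr0; apply: ideal0.
- by rewrite trL; apply: idealD => //; apply: QZ.
- by move/Qtrunc.
pose p : {mpoly k[n]} :=
  \sum_(m : T) (w (enum_rank m) ord0 / (mfact m)%:R) *: 'X_[m].
have fact0 m : (mfact m : nat)%:R != 0 :> k.
  move/pcharf0P: hk => ->; rewrite -lt0n; apply: prodn_gt0 => i.
  exact: fact_gt0.
have apE h : apolar h p = (vec h *m w) ord0 ord0.
  rewrite linear_sum mxE (reindex enum_rank) /=; last first.
    exact/onW_bij/enum_rank_bij.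
  apply: eq_bigr => m _; rewrite linearZ /= apolarX mxE enum_rankK.
  by rewrite -[h@_m *+ _]mulr_natr mulrCA divfK.
exists p => [h /Qtrunc /wQ|]; rewrite apE; first by move->; rewrite mxE.
apply: contra wh0 => /eqP w0; apply/eqP/matrixP => i j.
by rewrite !ord1 w0 mxE.
Qed.

(** * The theorem *)

(** Stability under multiplication by a variable is the adjointness: in the
    shifted coordinates the variable is [X_i + x_i], and multiplying by [X_i]
    turns [D^a p] into [D^(a + e_i) p]. *)
Lemma apolar_orthogonal_ideal (k : comNzRingType) n (p : {mpoly k[n]}) x :
  is_ideal (fun g => forall a, apolar (mshift x g) p^`M[a] = 0).
Proof.
split=> [a|g h Hg Hh a|g h].
- by rewrite rmorph0 /apolar big1 // => m _; rewrite mcoeff0 mul0rn mulr0.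
- by rewrite rmorphD apolarDl Hg Hh addr0.
elim/mpoly_ring_ind: g h => [c|i|g g' IH IH'|g g' IH IH'] h Hh a.
- by rewrite rmorphM /= mshiftC mul_mpolyC apolarZl Hh mulr0.
- rewrite rmorphM /= mshiftX mulrDl apolarDl mul_mpolyC apolarZl Hh mulr0 addr0.
  by rewrite -apolar_adjoint -mderivmDm.
- by rewrite mulrDl rmorphD apolarDl IH // IH' // addr0.
- by rewrite -mulrA; apply: IH => b; apply: IH'.
Qed.

(** The point [x] is a zero of [Q : f]. By maximality of [Q], if
    [y = X_j - x_j] did not carry [f] into [Q], then [1 - c y] would be in
    [Q : f] for some [c], although its value at [x] is [1]. Hence a power
    [(X_j - x_j)^(r_j)] is in [Q], and a monomial of degree greater than the sum
    of the [r_j] has some exponent at least [r_j]. The conclusion says that [Q]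
    contains the [N]-th power of the maximal ideal of [x]. *)
Lemma max_avoiding_primary (k : closedFieldType) n
    (Q : {mpoly k[n]} -> Prop) f :
  is_ideal Q -> ~ Q f -> (forall z, ~ Q z -> exists c, Q (f - c * z)) ->
  exists x N, forall m, (N <= mdeg m)%N -> Q (mshift (fun i => - x i) 'X_[m]).
Proof.
move=> HQ nQf maxQ.
have [|x x0] := weak_nullstellensatz (ideal_colon f HQ); first by rewrite mulr1.
pose y j : {mpoly k[n]} := 'X_j - (x j)%:MP.
have Qyf j : Q (y j * f).
  apply: NNPP => /maxQ[c Qc].
  have /x0/eqP : Q (f * (1 - c * y j)).
    by rewrite mulrBr mulr1 mulrCA [f * _]mulrC.
  rewrite !(rmorphB, rmorphM, rmorph1) /= mevalXU mevalC subrr mulr0 subr0.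
  by rewrite oner_eq0.
have Qyr j :=
  nilpotent_mod_max_avoiding (@noetherian_mpoly k n) HQ nQf maxQ (Qyf j).
pose r j := sval (constructive_indefinite_description _ (Qyr j)).
have rP j : Q (y j ^+ r j).
  exact: (svalP (constructive_indefinite_description _ (Qyr j))).
exists x, (\sum_j r j).+1 => m lem.
have [j lej] : exists j, (r j <= m j)%N.
  apply/existsP; apply: contraLR lem; rewrite negb_exists => /forallP ltr.
  rewrite -leqNgt -ltnS ltnS mdegE; apply: leq_sum => j _.
  by apply: ltnW; rewrite ltnNge.
rewrite mpolyXE_id rmorph_prod (bigD1 j) //= rmorphXn /= mshiftX mpolyCN.
by rewrite -(subnK lej) exprD -mulrA mulrCA; exact: (idealMr _ HQ (rP j)).
Qed.

Theorem mainTheorem2 (k : closedFieldType) (hk : [pchar k] =i pred0)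
    (n s : nat) (f : {mpoly k[n]}) (F : 'I_s -> {mpoly k[n]}) :
  in_gen_ideal F f <->
  (forall (p : {mpoly k[n]}) (x : 'I_n -> k),
     (forall (i : 'I_s) (a : 'X_{1..n}),
        (mpoly_diffop (p^`M[a]) (F i)).@[x] = 0) ->
     forall a : 'X_{1..n}, (mpoly_diffop (p^`M[a]) f).@[x] = 0).
Proof.
split=> [[g ->] p x HF | Hf].
  pose J h := forall a, apolar (mshift x h) p^`M[a] = 0.
  have HJ : is_ideal J := apolar_orthogonal_ideal p x.
  suff HJf : J (\sum_(i < s) g i * F i).
    by move=> a; rewrite mpoly_diffop_apolar.
  have JF i : J (F i) by move=> a; rewrite -mpoly_diffop_apolar.
  apply: (ideal_sum _ HJ) => i _; exact: (idealM HJ).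
apply: NNPP => nIf.
have [Q [HQ IQ nQf maxQ]] :=
  noetherian_max_avoiding (@noetherian_mpoly k n) (in_gen_ideal_ideal F) nIf.
have [x [N QN]] := max_avoiding_primary HQ nQf maxQ.
have HQ' := ideal_preim (mshift (fun i => - x i)) HQ.
have [|p pQ /eqP] := separating_apolar (h0 := mshift x f) hk HQ' QN.
  by rewrite /= mshiftK.
case; rewrite -[p]mderivm0m -mpoly_diffop_apolar; apply: Hf => i a.
rewrite mpoly_diffop_apolar apolar_adjoint; apply: pQ.
rewrite rmorphM /= mshiftK; apply: idealM => //; apply: IQ.
exact: in_gen_ideal_mem.
Qed.
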